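(* For each $\varepsilon>0$ there exist $\delta>0$ and $n_0\in\mathbb{N}$ such that the following holds. If $n\geq n_0$, $S\subset\mathbb{R}^3$ is a set of $n$ points, and $r\colon S\to(0,\infty)$ is a function with $e_r(S) > \left(\frac{1}{4}-\delta\right)n^2$, then there exists $T\subset S$ with $|T|<\varepsilon n$ such that $S\setminus T$ (with the restriction of $r$ to $S\setminus T$) is a suspension with some circle $\mathcal{C}$ and its symmetry axis $\mathcal{L}$, and moreover \[\bigl||S\cap\mathcal{C}|-n/2\bigr|<\varepsilon n\quad\text{and}\quad \bigl||S\cap\mathcal{L}|-n/2\bigr|<\varepsilon n.\]
   Context: Let $d(x,y)$ denote Euclidean distance in $\mathbb{R}^3$, and $d(x,A)$ the distance from the point $x$ to the set $A$. For a finite set $S\subset\mathbb{R}^3$ and a function $r\colon S\to(0,\infty)$, let $\vec{E}_r(S)=\{(x,y) : x,y\in S,\ d(x,y)=r(x)\}$ (a set of ordered pairs) and $e_r(S)=|\vec{E}_r(S)|$. The axis of symmetry of a circle $\mathcal{C}$ in $\mathbb{R}^3$ is the line through the centre of $\mathcal{C}$ perpendicular to the plane of $\mathcal{C}$. A finite set $S\subset\mathbb{R}^3$ together with a function $r\colon S\to(0,\infty)$ is called a suspension with circle $\mathcal{C}$ and symmetry axis $\mathcal{L}$ if $\mathcal{C}$ is a circle (of positive radius) in $\mathbb{R}^3$ with axis of symmetry $\mathcal{L}$, $S\subset\mathcal{C}\cup\mathcal{L}$, and $r(x)=d(x,\mathcal{C})$ for all $x\in S\cap\mathcal{L}$. 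*)

(* Defs.v *)
From mathcomp Require Import all_boot all_order all_algebra finmap.
From mathcomp Require Import all_classical all_reals.

Set Implicit Arguments.
Unset Strict Implicit.
Unset Printing Implicit Defensive.

Import Order.TTheory GRing.Theory Num.Theory.
Local Open Scope classical_set_scope.
Local Open Scope ring_scope.

(* The library norm on row vectors is the sup norm, hence an explicit
   inner product and Euclidean distance. *)
Definition dotp (R : realType) (u v : 'rV[R]_3) : R :=
  \sum_(i < 3) u ord0 i * v ord0 i.

Definition edist3 (R : realType) (x y : 'rV[R]_3) : R :=
  Num.sqrt (dotp (x - y) (x - y)).

(* Only meaningful for A nonempty: inf set0 is 0. *)
Definition edist3_set (R : realType) (x : 'rV[R]_3) (A : set 'rV[R]_3) : R :=
  inf [set edist3 x a | a in A].

(* A function S -> (0, oo) is encoded as r : R^3 -> R, of which only the values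
   on S are used; positivity on S is to be assumed separately. *)
Definition dist_pairs (R : realType) (S : {fset 'rV[R]_3}) (r : 'rV[R]_3 -> R) :
    {fset 'rV[R]_3 * 'rV[R]_3} :=
  [fset p in (S `*` S)%fset | edist3 p.1 p.2 == r p.1]%fset.

Definition num_dist_pairs (R : realType) (S : {fset 'rV[R]_3})
    (r : 'rV[R]_3 -> R) : nat := #|` dist_pairs S r|.

(* The circle with centre c and radius rho in the plane through c normal to u. *)
Definition circle3 (R : realType) (c u : 'rV[R]_3) (rho : R) : set 'rV[R]_3 :=
  [set x | dotp (x - c) u = 0 /\ edist3 x c = rho].

Definition line3 (R : realType) (c u : 'rV[R]_3) : set 'rV[R]_3 :=
  [set c + t *: u | t in [set: R]].

Definition circle_with_axis (R : realType) (C L : set 'rV[R]_3) : Prop :=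
  exists (c u : 'rV[R]_3) (rho : R),
    [/\ u != 0, 0 < rho, C = circle3 c u rho & L = line3 c u].

Definition suspension (R : realType) (S : {fset 'rV[R]_3}) (r : 'rV[R]_3 -> R)
    (C L : set 'rV[R]_3) : Prop :=
  [/\ circle_with_axis C L,
      (forall x, x \in S -> (C `|` L) x) &
      (forall x, x \in S -> L x -> r x = edist3_set x C)].

Definition num_in (R : realType) (S : {fset 'rV[R]_3}) (A : set 'rV[R]_3) : nat :=
  #|` [fset x in S | x \in A]%fset|.

(* Main.v *)
Require Import Defs.
From mathcomp Require Import all_boot all_order all_algebra zify ring lra.

Set Implicit Arguments.
Unset Strict Implicit.
Unset Printing Implicit Defensive.

Import Order.TTheory GRing.Theory Num.Theory.

(** Draw an arc from [x] to [y] when [d(x, y) = r(x)].  If two centres share at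
    least three out-neighbours, these are the points of [S] on the circle [C] where
    the two spheres meet, and any further centre joined to three of them lies on
    the axis of [C] and is joined to all of them.  Call [C] heavy if it carries at
    least a small positive proportion of [S].  By Cauchy-Schwarz all but few arcs go
    from [L(C)] to [C] for a heavy [C], where [L(C)] is the set of centres joined to
    all of [C].  There are boundedly many heavy circles, and the sets [C] and [L(C)]
    pairwise share at most two points, so the sum of [|C| + |L(C)|] is at most
    [n + O(1)] while the sum of [|C| |L(C)|] is close to [n^2 / 4].  This forces one
    pair [(C, L(C))] to have both parts close to [n / 2]. *)

(** * Double counting and Cauchy-Schwarz for families of finite sets *)

Lemma sum_mem_card (V I : finType) (P : pred I) (A : I -> {set V}) :
  \sum_(y : V) \sum_(i | P i) (y \in A i) = \sum_(i | P i) #|A i|.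
Proof.
rewrite [LHS]exchange_big /=; apply: eq_bigr => i _.
by rewrite -big_mkcond sum1_card.
Qed.

Lemma sum_mem_sqr (V I : finType) (P : pred I) (A : I -> {set V}) :
  \sum_(y : V) (\sum_(i | P i) (y \in A i)) ^ 2 =
  \sum_(i | P i) \sum_(j | P j) #|A i :&: A j|.
Proof.
under eq_bigr => y _ do rewrite -mulnn big_distrlr /=.
rewrite [LHS]exchange_big /=; apply: eq_bigr => i _.
rewrite [LHS]exchange_big /=; apply: eq_bigr => j _.
rewrite -sum1_card [RHS]big_mkcond /=; apply: eq_bigr => y _.
by rewrite inE; case: (y \in A i); case: (y \in A j).
Qed.

Lemma sqr_sum_card_le (V I : finType) (P : pred I) (A : I -> {set V}) :
  (\sum_(i | P i) #|A i|) ^ 2 <=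
  #|V| * \sum_(i | P i) \sum_(j | P j) #|A i :&: A j|.
Proof.
rewrite -sum_mem_card -sum_mem_sqr.
set d := fun y : V => \sum_(i | P i) (y \in A i).
(* Cauchy-Schwarz as the sum of [2 * (d x * d y) <= d x ^ 2 + d y ^ 2] over all ordered pairs. *)
rewrite -(leq_pmul2l (ltn0Sn 1)) -mulnn big_distrlr big_distrr /=.
have -> : 2 * (#|V| * \sum_y d y ^ 2) = \sum_x \sum_y (d x ^ 2 + d y ^ 2).
  under [RHS]eq_bigr => x _ do rewrite big_split /= sum_nat_const.
  by rewrite big_split /= sum_nat_const -big_distrr /= cardT; lia.
apply: leq_sum => x _; rewrite big_distrr; apply: leq_sum => y _ /=.
by rewrite nat_Cauchy.
Qed.

Lemma sum_cardI_le (V I : finType) (P : pred I) (A : I -> {set V}) (k : nat) :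
  (forall i j, P i -> P j -> i != j -> #|A i :&: A j| <= k) ->
  \sum_(i | P i) \sum_(j | P j) #|A i :&: A j| <=
  \sum_(i | P i) #|A i| + k * #|P| ^ 2.
Proof.
move=> hA.
have -> : k * #|P| ^ 2 = \sum_(i | P i) k * #|P|.
  by rewrite sum_nat_const; lia.
rewrite -big_split; apply: leq_sum => i Pi /=.
rewrite (bigD1 i) //= setIid leq_add2l.
apply: (@leq_trans (\sum_(j | P j && (j != i)) k)).
  by apply: leq_sum => j /andP[Pj ji]; apply: hA; rewrite // eq_sym.
rewrite sum_nat_const mulnC leq_mul2l; apply/orP; right.
by apply: subset_leq_card; apply/subsetP => j /andP[].
Qed.

(** Let [d y] count the sets containing [y]. Few overlaps keep the sum of [d ^ 2] within
    [k * #|P| ^ 2] of the sum of [d], and [2 * d <= 1 + d ^ 2] pointwise. *)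
Lemma sum_card_le (V I : finType) (P : pred I) (A : I -> {set V}) (k : nat) :
  (forall i j, P i -> P j -> i != j -> #|A i :&: A j| <= k) ->
  \sum_(i | P i) #|A i| <= #|V| + k * #|P| ^ 2.
Proof.
move=> /sum_cardI_le; rewrite -sum_mem_sqr -sum_mem_card.
pose d (y : V) := \sum_(i | P i) (y \in A i).
change (\sum_y d y ^ 2 <= \sum_y d y + k * #|P| ^ 2 ->
  \sum_y d y <= #|V| + k * #|P| ^ 2) => hA.
have : \sum_y 2 * d y <= \sum_y (1 + d y ^ 2).
  by apply: leq_sum => y _; rewrite -[d y in leqLHS]mul1n -(exp1n 2) nat_Cauchy.
rewrite -big_distrr big_split /= sum1_card -[#|xpredT|]/#|V|; lia.
Qed.

(** * Heavy common out-neighbourhoods in a spherical digraph *)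

Definition common_in (V : finType) (N : V -> {set V}) (C : {set V}) : {set V} :=
  [set z | C \subset N z].

(** Heavy circles are collected as vertex sets, not as pairs of centres, so a circle cut out by many
    pairs counts once. Their sets [L(C)] are given by [common_in]. *)
Definition heavy (V : finType) (N : V -> {set V}) (h : nat) : {set {set V}} :=
  [set C : {set V} | (h <= #|C|) &&
    [exists x, exists x', (x != x') && (C == N x :&: N x')]].

(* Sphere geometry in graph form.  Three centres whose spheres share three points
   lie on the axis of the circle carrying those points, so the third sphere
   contains the whole circle; and collinear points lie on no common sphere. *)
Definition spherical (V : finType) (N : V -> {set V}) : Prop :=
  forall x1 x2 x3, x1 != x2 -> x2 != x3 -> x3 != x1 ->
    2 < #|N x1 :&: N x2 :&: N x3| ->
    N x1 :&: N x2 \subset N x3 /\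
    forall x, ~ [/\ x1 \in N x, x2 \in N x & x3 \in N x].

Lemma heavyP (V : finType) (N : V -> {set V}) (h : nat) (C : {set V}) :
  reflect (h <= #|C| /\ exists x x', x != x' /\ C = N x :&: N x')
          (C \in heavy N h).
Proof.
rewrite inE; apply: (iffP andP) => -[hC].
  by case/existsP=> x /existsP[x' /andP[xx' /eqP CE]]; split=> //; exists x, x'.
case=> x [x' [xx' CE]]; split=> //.
by apply/existsP; exists x; apply/existsP; exists x'; rewrite xx' CE eqxx.
Qed.

(** The two centres that define [C] can be exchanged, one at a time, for [z] and [z']. *)
Lemma heavy_out_eq (V : finType) (N : V -> {set V}) (h : nat) (C : {set V}) z z' :
  spherical N -> 2 < h -> C \in heavy N h ->
  z \in common_in N C -> z' \in common_in N C -> z != z' -> N z :&: N z' = C.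
Proof.
move=> sN h3 /heavyP[hC [x [x' [xx' CE]]]]; rewrite !inE => Cz Cz' zz'.
have C3 : 2 < #|C| := leq_trans h3 hC.
(* One exchange: [a], [b], [c] share all of [C], so sphericity puts [N a :&: N c] inside [N b]. *)
have step a b c : a != b -> C = N a :&: N b -> C \subset N c -> a != c ->
    C = N a :&: N c.
  move=> ab Cab Cc ac; have [<- //|bc] := eqVneq b c.
  apply/eqP; rewrite eqEsubset subsetI Cc Cab subsetIl /= subsetI subsetIl /=.
  have ba : b != a by rewrite eq_sym.
  have [] := sN a c b ac _ ba; rewrite ?(eq_sym c) //.
  by rewrite setIAC -Cab (setIidPl Cc).
have [xz|xz] := eqVneq x z.
  by rewrite -{}xz in Cz zz' *; rewrite -(step x x' z').
have Cxz := step x x' z xx' CE Cz xz.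
by rewrite [RHS](step z x z') // 1?eq_sym // setIC.
Qed.

(** Two shared centres determine both sets, by [heavy_out_eq]. Three shared points would make both
    defining centres of [D] centres of [C] as well. *)
Lemma heavy_cap (V : finType) (N : V -> {set V}) (h : nat) (C D : {set V}) :
  spherical N -> 2 < h -> C \in heavy N h -> D \in heavy N h -> C != D ->
  #|common_in N C :&: common_in N D| <= 1 /\ #|C :&: D| <= 2.
Proof.
move=> sN h3 hC hD /eqP neqCD.
have L1 : #|common_in N C :&: common_in N D| <= 1.
  rewrite leqNgt; apply/negP => /card_gt1P[z [z' [/setIP[zC zD] /setIP[z'C z'D] zz']]].
  apply: neqCD; rewrite -(heavy_out_eq sN h3 hC zC z'C zz').
  exact: heavy_out_eq sN h3 hD zD z'D zz'.
split=> //; rewrite leqNgt; apply/negP => CD3.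
case/heavyP: (hC) => _ [x [x' [xx' CE]]].
case/heavyP: (hD) => _ [y [y' [yy' DE]]].
have xC : x \in common_in N C by rewrite inE CE subsetIl.
have x'C : x' \in common_in N C by rewrite inE CE subsetIr.
have inC z : D \subset N z -> z \in common_in N C.
  move=> Dz; have [->//|zx] := eqVneq z x; have [->//|zx'] := eqVneq z x'.
  rewrite inE CE; have [] // := sN x x' z; rewrite 1?eq_sym // 1?eq_sym //.
  apply: leq_trans CD3 _; rewrite -CE; apply: subset_leq_card.
  exact: setIS.
have : 1 < #|common_in N C :&: common_in N D|.
  apply/card_gt1P; exists y, y'; split=> //; rewrite inE inC ?inE DE //.
  - by rewrite subsetIl.
  - by rewrite subsetIl.
  - by rewrite subsetIr.
  - by rewrite subsetIr.
by rewrite ltnNge L1.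
Qed.

(** Three such points would be centres sharing all of [D], hence as if collinear, yet all
    out-neighbours of a single centre of [C]. *)
Lemma heavy_in_cap (V : finType) (N : V -> {set V}) (h : nat) (C D : {set V}) :
  spherical N -> 2 < h -> C \in heavy N h -> D \in heavy N h ->
  #|C :&: common_in N D| <= 2.
Proof.
move=> sN h3 /heavyP[_ [x [x' [_ ->]]]] /heavyP[hD _].
rewrite leqNgt; apply/negP => /card_gt2P[y1 [y2 [y3 [[]]]]].
rewrite !inE => /andP[/andP[xy1 _] D1] /andP[/andP[xy2 _] D2] /andP[/andP[xy3 _] D3].
case=> n12 n23 n31; have [] := sN y1 y2 y3 n12 n23 n31.
  apply: leq_trans h3 (leq_trans hD _); apply: subset_leq_card.
  by rewrite !subsetI D1 D2.
by move=> _ /(_ x); case.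
Qed.

(* Cauchy-Schwarz bounds the total size [s] of the heavy sets by
   [s ^ 2 <= n * (s + 2 * f ^ 2)], where [f] is their number. *)
Lemma card_heavy_le (V : finType) (N : V -> {set V}) (h : nat) :
  spherical N -> 2 < h -> 4 * #|V| <= h ^ 2 -> #|heavy N h| * h <= 2 * #|V|.
Proof.
move=> sN h3 Vh; set n := #|V| in Vh *; set f := #|heavy N h|.
pose s := \sum_(C in heavy N h) #|C|.
have fs : f * h <= s.
  by rewrite -sum_nat_const; apply: leq_sum => C /heavyP[].
have s2 : s ^ 2 <= n * (s + 2 * f ^ 2).
  apply: leq_trans (sqr_sum_card_le _ id) _; rewrite leq_mul2l.
  apply/orP; right; apply: sum_cardI_le => C D hC hD CD.
  by have [] := heavy_cap sN h3 hC hD CD.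
(* The overlap term [2 * n * f ^ 2] is thus at most half of [s ^ 2], leaving
   [s ^ 2 <= 2 * n * s]. *)
have : 4 * n * f ^ 2 <= s ^ 2.
  by apply: leq_trans (_ : (f * h) ^ 2 <= _); [rewrite expnMn mulnC leq_mul2l Vh orbT | rewrite leq_exp2r].
move=> nf; apply: leq_trans fs _.
have : s ^ 2 <= 2 * n * s by nia.
have [->//|s0] := posnP s.
by rewrite -mulnn leq_pmul2r.
Qed.

(** All the sets [C] and [common_in N C] form one family, tagged by a boolean, with pairwise
    overlaps at most 2. Its [2 * f] members give the error [2 * (2 * f) ^ 2]. *)
Lemma sum_heavy_le (V : finType) (N : V -> {set V}) (h : nat) :
  spherical N -> 2 < h ->
  \sum_(C in heavy N h) #|C| + \sum_(C in heavy N h) #|common_in N C| <=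
  #|V| + 8 * #|heavy N h| ^ 2.
Proof.
move=> sN h3.
pose P (p : bool * {set V}) := p.2 \in heavy N h.
pose A (p : bool * {set V}) := if p.1 then p.2 else common_in N p.2.
have cardP : #|P| = 2 * #|heavy N h|.
  rewrite -card_bool -cardsT -cardsX; apply: eq_card => -[b C].
  by rewrite in_setX in_setT.
have sumA : \sum_(p | P p) #|A p| =
    \sum_(C in heavy N h) #|C| + \sum_(C in heavy N h) #|common_in N C|.
  rewrite (_ : \sum_(p | P p) #|A p| =
    \sum_(b : bool) \sum_(C in heavy N h) #|A (b, C)|); last first.
    by rewrite pair_big /=; apply: eq_big => -[].
  by rewrite big_bool.
rewrite -sumA; apply: (@leq_trans (#|V| + 2 * #|P| ^ 2)); last first.
  by rewrite cardP; lia.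
apply: sum_card_le => -[b C] [c D] /= hC hD neq; rewrite /A /=.
have CD : b = c -> C != D.
  by move=> bc; apply: contraNneq neq => ->; rewrite bc.
case: b c CD hC hD {neq} => -[] CD hC hD; last 1 first.
- by apply: leq_trans (heavy_cap sN h3 hC hD (CD erefl)).1 _.
- by case: (heavy_cap sN h3 hC hD (CD erefl)).
- exact: heavy_in_cap sN h3 hC hD.
- by rewrite setIC; exact: heavy_in_cap sN h3 hD hC.
Qed.

(* An arc is light if no heavy set accounts for it.  Two vertices share fewer than
   [h] light out-neighbours, since otherwise their common out-neighbourhood would
   itself be heavy; Cauchy-Schwarz then bounds the number [b] of light arcs. *)
Lemma light_arcs_le (V : finType) (N : V -> {set V}) (h : nat) :
  exists b, b ^ 2 <= #|V| ^ 3 * h.+1 /\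
    \sum_z #|N z| <= b + \sum_(C in heavy N h) #|C| * #|common_in N C|.
Proof.
(* Light arcs from [z] are those ending outside [G z]. *)
pose G z := \bigcup_(C in heavy N h | z \in common_in N C) C.
exists (\sum_z #|N z :\: G z|); split.
  apply: leq_trans (sqr_sum_card_le _ _) _.
  rewrite expnS -mulnA leq_mul2l; apply/orP; right.
  apply: (@leq_trans (\sum_z #|N z :\: G z| + h * #|V| ^ 2)).
    apply: sum_cardI_le => z z' _ _ zz'.
    have [hD|] := leqP h #|N z :&: N z'|; last first.
      move=> /ltnW; apply: leq_trans; apply: subset_leq_card.
      by apply: setISS; exact: subsetDl.
    have DF : N z :&: N z' \in heavy N h by apply/heavyP; split=> //; exists z, z'.
    rewrite (_ : _ :&: _ = set0) ?cards0 //; apply/setP => y; rewrite !inE.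
    apply/negP => /andP[/andP[/negP yG yz] /andP[_ yz']]; apply: yG.
    apply/bigcupP; exists (N z :&: N z'); last by rewrite inE yz.
    by rewrite DF inE subsetIl.
  (* The diagonal term is at most [#|V| ^ 2], which accounts for the successor in [h.+1]. *)
  rewrite mulnSr addnC mulnC leq_add2l -mulnn -sum_nat_const.
  by apply: leq_sum => z _; exact: max_card.
have -> : \sum_(C in heavy N h) #|C| * #|common_in N C| =
    \sum_z \sum_(C in heavy N h | z \in common_in N C) #|C|.
  rewrite (exchange_big_dep (mem (heavy N h))) /=; last by move=> z C _ /andP[].
  apply: eq_bigr => C hC; rewrite mulnC -sum_nat_const.
  by apply: eq_bigl => z; rewrite hC.
rewrite -big_split; apply: leq_sum => z _ /=.
rewrite -[leqLHS](cardsID (G z)) addnC leq_add2l.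
apply: leq_trans (subset_leq_card (subsetIr _ _)) _.
rewrite /G; elim/big_rec2: _ => [|C m U _ le]; first by rewrite cards0.
by rewrite cardsU; apply: leq_trans (leq_subr _ _) _; rewrite leq_add2l.
Qed.

Lemma heavyW (V : finType) (N : V -> {set V}) (h k : nat) (C : {set V}) :
  k <= h -> C \in heavy N h -> C \in heavy N k.
Proof.
by move=> kh /heavyP[hC E]; apply/heavyP; split=> //; exact: leq_trans hC.
Qed.

(** Splits off a largest heavy set [D]; [a'] and [b'] are the sums over the others. The first bound
    is maximality, the second bounds a sum of products by the product of the sums. *)
Lemma sum_heavy_mul_le (V : finType) (N : V -> {set V}) (h : nat) (D : {set V}) :
  let g := \sum_(C in heavy N h) #|C| * #|common_in N C| in
  let a := \sum_(C in heavy N h) #|common_in N C| in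
  let b := \sum_(C in heavy N h) #|C| in
  D \in heavy N h -> (forall C, C \in heavy N h -> #|C| <= #|D|) ->
  exists a' b', [/\ a = #|common_in N D| + a', b = #|D| + b',
    g <= #|D| * a & g <= #|D| * #|common_in N D| + a' * b'].
Proof.
move=> g a b hD maxD.
exists (\sum_(C in heavy N h | C != D) #|common_in N C|).
exists (\sum_(C in heavy N h | C != D) #|C|).
split; [by rewrite /a (bigD1 D) | by rewrite /b (bigD1 D) | |].
  by rewrite big_distrr; apply: leq_sum => C hC; rewrite leq_mul2r maxD ?orbT.
rewrite /g (bigD1 D) //= leq_add2l mulnC big_distrl; apply: leq_sum => C hC /=.
by rewrite leq_mul2l [X in _ || (_ <= X)](bigD1 C) ?leq_addr ?orbT.
Qed.

(** * Numerical stability and choice of constants *)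

Local Open Scope ring_scope.

(** The bound [g <= m * (l + a')] forces both factors close to [n / 2]. This leaves little room for
    [b'], so [a' * b'] is small and [m * l] must carry almost all of [g]. *)
Lemma near_extremal_product (R : realFieldType) (n g m l a' b' s : R) :
  0 < n -> 0 < s -> 0 <= m -> 0 <= l -> 0 <= a' -> 0 <= b' ->
  (l + a') + (m + b') <= n -> g <= m * (l + a') -> g <= m * l + a' * b' ->
  (1 / 4 - s ^+ 2) * n ^+ 2 <= g ->
  (1 / 2 - s) * n <= m /\ (1 / 2 - 5 * s) * n <= l.
Proof.
move=> n0 s0 m0 l0 a0 b0 le_n g1 g2 g3.
have sn0 : 0 < s * n by rewrite mulr_gt0.
(* [(x - n / 2) ^ 2 <= n ^ 2 / 4 - x * y] when [x + y <= n]. *)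
have near x y : 0 <= x -> 0 <= y -> x + y <= n -> g <= x * y ->
    `|x - n / 2| <= s * n.
  move=> x0 y0 xy gxy; rewrite -(@ler_pXn2r _ 2) ?nnegrE ?normr_ge0 ?(ltW sn0) //.
  rewrite real_normK ?num_real //.
  have : x * y <= x * (n - x) by apply: ler_wpM2l => //; lra.
  nra.
have lM : `|m - n / 2| <= s * n by apply: near g1 => //; lra.
have lA : `|l + a' - n / 2| <= s * n.
  by apply: (near _ m) => //; rewrite 1?mulrC; lra.
move: lM lA; rewrite !ler_norml => /andP[M1 M2] /andP[A1 A2].
split; first by lra.
have b2 : b' <= 2 * s * n by lra.
(* Otherwise [g] is at most [((1/2 + s) * (1/2 - 5 * s) + 2 * s) * n ^ 2 = (1/4 - 5 * s ^ 2) * n ^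
   2]; the factor 5 cancels the terms linear in [s]. *)
rewrite leNgt; apply/negP => l1.
have ab : a' * b' <= n * (2 * s * n) by apply: ler_pM => //; lra.
have ml : m * l <= (n / 2 + s * n) * ((1 / 2 - 5 * s) * n).
  by apply: ler_pM => //; lra.
have : 0 < s * n ^+ 2 by rewrite mulr_gt0 // exprn_gt0.
have : 0 < (s * n) ^+ 2 by rewrite exprn_gt0.
nra.
Qed.

Lemma spherical_stability (R : archiRealFieldType) (eps : R) : 0 < eps ->
  exists (delta : R) (n0 : nat), 0 < delta /\
    forall (V : finType) (N : V -> {set V}), spherical N -> (n0 <= #|V|)%N ->
      (1 / 4 - delta) * #|V|%:R ^+ 2 < (\sum_z #|N z|)%:R ->
      exists2 C, C \in heavy N 3 &
        (1 / 2 - eps) * #|V|%:R <= #|C|%:R /\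
        (1 / 2 - eps) * #|V|%:R <= #|common_in N C|%:R.
Proof.
move=> eps0; have [s [s0 s1 s2]] : exists s, [/\ 0 < s, 5 * s <= eps & s <= 1 / 10].
  exists (Num.min eps (1 / 2) / 5).
  have : Num.min eps (1 / 2) <= eps by rewrite ge_min lexx.
  have : Num.min eps (1 / 2) <= 1 / 2 by rewrite ge_min lexx orbT.
  have : 0 < Num.min eps (1 / 2) by rewrite lt_min eps0; lra.
  by split; lra.
(* Heavy means at least [e * n] points, up to rounding: then there are at most
   [2 / e] heavy sets and at most [t * n ^ 2] light arcs, and [n0] is chosen so that
   the overlaps of the heavy sets and their centre sets total at most [t * n]. *)
have [t tE] : exists t, t = s ^+ 2 / 3 by exists (s ^+ 2 / 3).
have [e eE] : exists e, e = t ^+ 2 / 2 by exists (t ^+ 2 / 2).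
have ss1 : s ^+ 2 <= 1 / 25 by nra.
have t0 : 0 < t by rewrite tE divr_gt0 // exprn_gt0.
have t1 : t <= 1 / 75 by rewrite tE; lra.
have e0 : 0 < e by rewrite eE divr_gt0 // exprn_gt0.
have e1 : e <= 1 by rewrite eE; nra.
pose n0 := Num.bound (32 / (e ^+ 2 * t)).
exists t, n0; split=> // V N sN n0V.
set n : R := #|V|%:R => hN.
have nbig : 32 <= e ^+ 2 * t * n.
  rewrite mulrC -ler_pdivrMr ?mulr_gt0 ?exprn_gt0 //.
  apply: le_trans (_ : n0%:R <= _); last by rewrite ler_nat.
  by apply/ltW/archi_boundP; rewrite divr_ge0 // mulr_ge0 ?exprn_ge0 ?ltW.
have n_gt0 : 0 < n.
  have et : 0 < e ^+ 2 * t by rewrite mulr_gt0 // exprn_gt0.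
  by have := lt_le_trans (ltr0Sn R 31) nbig; rewrite pmulr_rgt0.
have e2n : 32 <= e ^+ 2 * n.
  apply: le_trans nbig _; rewrite -mulrA ler_pM2l ?exprn_gt0 //.
  by rewrite ler_piMl ?ltW //; lra.
have en : 32 <= e * n.
  apply: le_trans e2n _; by rewrite ler_pM2r // expr2 ler_piMr // ltW.
(* The offset 3 rounds [e * n] up and makes [2 < h] hold by computation. *)
pose h := (Num.truncn (e * n)).+3.
have [hge hle] : e * n <= h%:R /\ h%:R <= e * n + 3.
  have /andP[h1 h2] := truncn_itv (ltW (mulr_gt0 e0 n_gt0)).
  by move: h2; rewrite /h -!natr1; lra.
have h3 : (2 < h)%N by [].
have Vh : (4 * #|V| <= h ^ 2)%N.
  rewrite -(ler_nat R) natrX natrM -/n.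
  have : (e * n) ^+ 2 <= h%:R ^+ 2.
    by rewrite ler_pXn2r ?nnegrE ?ler0n // mulr_ge0 ?ltW.
  have : 32 * n <= e ^+ 2 * n * n by move: e2n; rewrite -(ler_pM2r n_gt0).
  lra.
pose f : R := #|heavy N h|%:R.
have f_le : f * e <= 2.
  have := card_heavy_le sN h3 Vh.
  rewrite -(ler_nat R) !natrM -/n -/f => fh.
  have : f * (e * n) <= f * h%:R by rewrite ler_wpM2l ?ler0n.
  by move=> fen; rewrite -(ler_pM2r n_gt0); lra.
(* Since [f * e <= 2], [8 * (f * e) ^ 2 <= 32], the constant in [n0]. *)
have f2 : 8 * f ^+ 2 <= t * n.
  have : (f * e) ^+ 2 <= 4.
    by have : 0 <= f * e := mulr_ge0 (ler0n _ _) (ltW e0); nra.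
  rewrite exprMn => fe4.
  rewrite -(ler_pM2l (_ : 0 < e ^+ 2)) ?exprn_gt0 //.
  by move: nbig fe4; lra.
have [b [b2 bN]] := light_arcs_le N h.
have b_le : b%:R <= t * n ^+ 2.
  have tn : 0 <= t * n ^+ 2 by rewrite mulr_ge0 ?exprn_ge0 ?ltW.
  rewrite -(@ler_pXn2r _ 2) ?nnegrE ?ler0n //.
  move: b2; rewrite -(ler_nat R) natrM !natrX -/n -natr1 => /le_trans; apply.
  have n3 : 0 < n ^+ 3 by rewrite exprn_gt0.
  (* With [e = t ^ 2 / 2], [n ^ 3 * (2 * (e * n))] is exactly [(t * n ^ 2) ^ 2]. *)
  have : h%:R + 1 <= 2 * (e * n) by lra.
  rewrite -(ler_pM2l n3 (_ + _)) => /le_trans; apply.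
  by rewrite le_eqVlt; apply/orP; left; apply/eqP; rewrite eE; field.
set g := (\sum_(C in heavy N h) _)%N in bN.
(* One [t] is [delta], the other pays for the light arcs. *)
have g_ge : (1 / 4 - 2 * t) * n ^+ 2 <= g%:R.
  by move: bN; rewrite -(ler_nat R) natrD; lra.
have [hF|[C0 hC0]] := set_0Vmem (heavy N h).
  have : 0 < (1 / 4 - 2 * t) * n ^+ 2 by rewrite mulr_gt0 ?exprn_gt0 //; lra.
  by move: g_ge; rewrite /g hF big_set0; lra.
case: (arg_maxnP (fun C : {set V} => #|C|) hC0) => C hC maxC.
exists C; first exact: heavyW hC.
have [a' [b' [aE bE g1 g2]]] := sum_heavy_mul_le hC maxC.
have := sum_heavy_le sN h3; rewrite aE bE => le_n.
(* The total is bounded by [n + 8 * f ^ 2 <= (1 + t) * n] rather than [n]. The choice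
   [s ^ 2 = 3 * t] absorbs this: [(1/4 - 3 * t) * (1 + t) ^ 2 <= 1/4 - 2 * t]. *)
have [|||||c1 c2] := @near_extremal_product R (n + 8 * f ^+ 2) g%:R _ _ _ _ s
  _ s0 (ler0n R #|C|) (ler0n R #|common_in N C|) (ler0n R a') (ler0n R b').
- by rewrite ltr_wpDr // mulr_ge0 // exprn_ge0 // ler0n.
- by move: le_n; rewrite -(ler_nat R) 3!natrD (natrD _ #|V|) natrM natrX -/n -/f; lra.
- by move: g1; rewrite aE -(ler_nat R) natrM natrD.
- by move: g2; rewrite -(ler_nat R) natrD !natrM.
- apply: le_trans g_ge.
  have : (n + 8 * f ^+ 2) ^+ 2 <= ((1 + t) * n) ^+ 2.
    have f20 : 0 <= f ^+ 2 by rewrite exprn_ge0 ?ler0n.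
    by rewrite ler_pXn2r ?nnegrE //; lra.
  set N' := _ ^+ 2 => N'le.
  apply: le_trans (_ : (1 / 4 - s ^+ 2) * ((1 + t) * n) ^+ 2 <= _).
    by rewrite ler_wpM2l //; lra.
  have -> : s ^+ 2 = 3 * t by rewrite tE; field.
  rewrite exprMn mulrA ler_wpM2r ?exprn_ge0 ?ltW //; nra.
have f20 : 0 <= f ^+ 2 by rewrite exprn_ge0 ?ler0n.
have c_le c : (1 / 2 - 5 * s) * (n + 8 * f ^+ 2) <= c -> (1 / 2 - eps) * n <= c.
  move=> /(le_trans _); apply; apply: (@le_trans _ _ ((1 / 2 - 5 * s) * n)).
    by rewrite ler_wpM2r ?(ltW n_gt0) //; lra.
  by rewrite ler_wpM2l //; lra.
split; apply: c_le => //.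
apply: le_trans c1; rewrite ler_wpM2r //; lra.
Qed.

(* Spheres, circles and axes in three-dimensional space *)
From mathcomp Require Import finmap.
From mathcomp Require Import all_classical all_reals.

Lemma dotpE (R : realType) (u v : 'rV[R]_3) :
  dotp u v = u ord0 0 * v ord0 0 + u ord0 1 * v ord0 1 + u ord0 2 * v ord0 2.
Proof.
rewrite /dotp !big_ord_recl big_ord0 addr0 addrA.
by congr (_ + u _ _ * v _ _ + u _ _ * v _ _); apply: val_inj.
Qed.

Lemma dotp_mul (R : realType) (u v : 'rV[R]_3) : u *m v^T = (dotp u v)%:M.
Proof.
apply/matrixP => i j; rewrite !ord1 !mxE eqxx mulr1n; apply: eq_bigr => k _.
by rewrite mxE.
Qed.

Lemma dotp_ge0 (R : realType) (u : 'rV[R]_3) : 0 <= dotp u u.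
Proof. by apply: sumr_ge0 => i _; rewrite -expr2 sqr_ge0. Qed.

Lemma dotp_gt0 (R : realType) (u : 'rV[R]_3) : (0 < dotp u u) = (u != 0).
Proof.
rewrite lt_def dotp_ge0 andbT; congr (~~ _); apply/eqP/eqP => [|->].
  move=> u0; apply/rowP => i; rewrite mxE; apply/eqP.
  have /eqP := u0; rewrite psumr_eq0 => [/allP/(_ i)|j _].
    by rewrite mem_index_enum mulf_eq0 orbb; apply.
  by rewrite -expr2 sqr_ge0.
by rewrite /dotp big1 // => i _; rewrite mxE mul0r.
Qed.

Lemma edist3_eq (R : realType) (x y x' y' : 'rV[R]_3) :
  edist3 x y = edist3 x' y' <-> dotp (x - y) (x - y) = dotp (x' - y') (x' - y').
Proof.
rewrite /edist3; split=> [|->//] e.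
by rewrite -[LHS]sqr_sqrtr ?dotp_ge0 // e sqr_sqrtr ?dotp_ge0.
Qed.

Lemma rank_col_mx_gt1 (F : fieldType) (n : nat) (u v : 'rV[F]_n) :
  u != 0 -> ~~ (v <= u)%MS -> (1 < \rank (col_mx u v))%N.
Proof.
move=> u0 vu; have rk1 : \rank u = 1%N by rewrite rank_rV u0.
rewrite -addsmxE; have := mxrank_leqif_sup (addsmxSl u v).
by rewrite rk1 addsmx_sub submx_refl (negbTE vu) => -[le1 /negbT ne1]; rewrite ltn_neqAle ne1.
Qed.

(** Otherwise two mutually orthogonal planes would have ranks adding up to 4 in dimension 3. *)
Lemma perp_pairs (R : realType) (p q u v : 'rV[R]_3) : p != 0 -> u != 0 ->
  dotp p u = 0 -> dotp p v = 0 -> dotp q u = 0 -> dotp q v = 0 ->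
  (q <= p)%MS \/ (v <= u)%MS.
Proof.
move=> p0 u0 pu pv qu qv; apply/orP; rewrite -[_ || _]negbK negb_or.
apply/negP => /andP[qp vu].
have AB0 : col_mx p q *m (col_mx u v)^T = 0.
  rewrite tr_col_mx mul_col_mx !mul_mx_row !dotp_mul pu pv qu qv.
  by rewrite !raddf0 !row_mx0 col_mx0.
have := mulmx0_rank_max AB0; rewrite mxrank_tr leqNgt => /negP; apply.
exact: leq_trans (leq_add (rank_col_mx_gt1 p0 qp) (rank_col_mx_gt1 u0 vu)).
Qed.

(** Along the line through [a] and [b] the squared distance to [x] is a quadratic in [t], equal at 0
    and 1, hence taking that value nowhere else. *)
Lemma line_sphere (R : realType) (x a b c : 'rV[R]_3) (t : R) :
  a != b -> b != c -> c != a -> c - a = t *: (b - a) ->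
  edist3 x a = edist3 x b -> edist3 x a = edist3 x c -> False.
Proof.
move=> ab bc ca /(canRL (subrK a)) cE /edist3_eq xab /edist3_eq xac.
have P0 : 0 < dotp (b - a) (b - a) by rewrite dotp_gt0 subr_eq0 eq_sym.
have : t * (t - 1) * dotp (b - a) (b - a) = 0.
  have -> : t * (t - 1) * dotp (b - a) (b - a) =
      (dotp (x - c) (x - c) - dotp (x - a) (x - a)) -
      t * (dotp (x - b) (x - b) - dotp (x - a) (x - a)).
    by rewrite cE !dotpE !mxE; ring.
  by rewrite -xab -xac !subrr mulr0 subrr.
move/eqP; rewrite mulf_eq0 (gt_eqF P0) orbF mulf_eq0 subr_eq0.
case/orP => /eqP t01; move: cE; rewrite t01.
  by rewrite scale0r add0r => /eqP; rewrite (negbTE ca).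
by rewrite scale1r subrK => /eqP; rewrite eq_sym (negbTE bc).
Qed.

Lemma bisector_perp (R : realType) (x1 x2 y1 y2 : 'rV[R]_3) :
  edist3 x1 y1 = edist3 x1 y2 -> edist3 x2 y1 = edist3 x2 y2 ->
  dotp (y2 - y1) (x2 - x1) = 0.
Proof. move=> /edist3_eq + /edist3_eq; rewrite !dotpE !mxE; lra. Qed.

(** Differences of the [y]s are orthogonal to differences of the centres. By [perp_pairs] one of the
    two triples is collinear, and [line_sphere] excludes the [y]s. *)
Lemma common_centres_collinear (R : realType) (x1 x2 x3 y1 y2 y3 : 'rV[R]_3) :
  x1 != x2 -> y1 != y2 -> y2 != y3 -> y3 != y1 ->
  edist3 x1 y1 = edist3 x1 y2 -> edist3 x1 y1 = edist3 x1 y3 ->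
  edist3 x2 y1 = edist3 x2 y2 -> edist3 x2 y1 = edist3 x2 y3 ->
  edist3 x3 y1 = edist3 x3 y2 -> edist3 x3 y1 = edist3 x3 y3 ->
  exists t, x3 - x1 = t *: (x2 - x1).
Proof.
move=> x12 y12 y23 y31 e12 e13 f12 f13 g12 g13.
have [||||||/sub_rVP[t yt]|/sub_rVP//] :=
  @perp_pairs R (y2 - y1) (y3 - y1) (x2 - x1) (x3 - x1).
- by rewrite subr_eq0 eq_sym.
- by rewrite subr_eq0 eq_sym.
- exact: bisector_perp.
- exact: bisector_perp.
- exact: bisector_perp.
- exact: bisector_perp.
- by case: (line_sphere y12 y23 y31 yt e12 e13).
Qed.

(** The bisector plane of [y] and [y'] contains the line through [x1] and [x2]. *)
Lemma sphere_pencil (R : realType) (x1 x2 x3 y y' : 'rV[R]_3) (t : R) :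
  x3 - x1 = t *: (x2 - x1) ->
  edist3 x1 y = edist3 x1 y' -> edist3 x2 y = edist3 x2 y' ->
  edist3 x3 y = edist3 x3 y'.
Proof.
move=> /(canRL (subrK x1)) -> e1 e2; have p := bisector_perp e1 e2.
apply/edist3_eq; move/edist3_eq: e1 => e1.
have : 2 * t * dotp (y' - y) (x2 - x1) = 0 by rewrite p mulr0.
move: e1; rewrite !dotpE !mxE; lra.
Qed.

Lemma axis_equidistant (R : realType) (c u z y y' : 'rV[R]_3) (rho : R) :
  line3 c u z -> circle3 c u rho y -> circle3 c u rho y' ->
  edist3 z y = edist3 z y'.
Proof.
case=> t _ <- [pu ey] [pu' ey']; apply/edist3_eq.
have /edist3_eq : edist3 y c = edist3 y' c by rewrite ey.
have : 2 * t * (dotp (y - c) u - dotp (y' - c) u) = 0 by rewrite pu pu' subrr mulr0.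
rewrite !dotpE !mxE; lra.
Qed.

Lemma circle_line_disjoint (R : realType) (c u y : 'rV[R]_3) (rho : R) :
  u != 0 -> 0 < rho -> circle3 c u rho y -> ~ line3 c u y.
Proof.
move=> u0 rho0 [pu ey] [t _ yE]; move: pu ey; rewrite -yE.
have -> : dotp (c + t *: u - c) u = t * dotp u u by rewrite !dotpE !mxE; ring.
move/eqP; rewrite mulf_eq0 (gt_eqF (_ : 0 < dotp u u)) ?dotp_gt0 // orbF.
move=> /eqP ->; rewrite scale0r addr0 /edist3 subrr /dotp big1 => [|i _].
  by rewrite sqrtr0 => rho_eq; move: rho0; rewrite -rho_eq ltxx.
by rewrite mxE mul0r.
Qed.

Lemma spheres_meet_in_circle (R : realType) (x1 x2 y1 y2 : 'rV[R]_3) :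
  x1 != x2 -> y1 != y2 ->
  edist3 x1 y1 = edist3 x1 y2 -> edist3 x2 y1 = edist3 x2 y2 ->
  exists (c u : 'rV[R]_3) (rho : R),
    [/\ u != 0, 0 < rho,
      forall y, circle3 c u rho y <->
        edist3 x1 y = edist3 x1 y1 /\ edist3 x2 y = edist3 x2 y1 &
      forall t, line3 c u (x1 + t *: (x2 - x1))].
Proof.
move=> x12 y12 e1 e2; pose u := x2 - x1.
have u0 : u != 0 by rewrite subr_eq0 eq_sym.
have uu0 : dotp u u != 0 by rewrite gt_eqF // dotp_gt0.
(* The centre [c] is the foot of the perpendicular from [y1] to the line of centres. *)
pose s := dotp (y1 - x1) u / dotp u u; pose c := x1 + s *: u.
have y1c : dotp (y1 - c) u = 0.
  have -> : dotp (y1 - c) u = dotp (y1 - x1) u - s * dotp u u.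
    by rewrite !dotpE !mxE; ring.
  by rewrite divfK // subrr.
have onaxis t : line3 c u (x1 + t *: u).
  by exists (t - s) => //; rewrite /c scalerBl addrA addrAC addrK addrC.
clearbody s.
have circP y : circle3 c u (edist3 y1 c) y <->
    edist3 x1 y = edist3 x1 y1 /\ edist3 x2 y = edist3 x2 y1.
  split=> [cy|[f1 f2]].
    have cy1 : circle3 c u (edist3 y1 c) y1 by [].
    split; apply: axis_equidistant cy cy1; first by have := onaxis 0; rewrite scale0r addr0.
    by have := onaxis 1; rewrite scale1r addrC subrK.
  have p := bisector_perp f1 f2.
  have yc : dotp (y - c) u = 0.
    have -> : dotp (y - c) u = dotp (y1 - c) u - dotp (y1 - y) u.
      by rewrite !dotpE !mxE; ring.
    by rewrite y1c p subrr.
  split=> //; apply/edist3_eq; move/edist3_eq: f1.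
  have : 2 * s * (dotp (y - c) u - dotp (y1 - c) u) = 0 by rewrite yc y1c subrr mulr0.
  have -> : x1 = c - s *: u by rewrite addrK.
  by rewrite !dotpE !mxE; lra.
exists c, u, (edist3 y1 c); split=> //.
(* Radius zero would give [y1 = c = y2]. *)
have cy2 : circle3 c u (edist3 y1 c) y2 by apply/circP.
rewrite /edist3 sqrtr_gt0 dotp_gt0 subr_eq0; apply/eqP => y1E.
case: cy2 => _ /edist3_eq; rewrite -y1E subrr {2}/dotp big1 => [|i _]; last first.
  by rewrite mxE mul0r.
by apply/eqP; rewrite gt_eqF // dotp_gt0 subr_eq0 eq_sym.
Qed.

(** * The distance digraph on [S] and the suspension *)

Definition out_nbrs (R : realType) (S : {fset 'rV[R]_3}) (r : 'rV[R]_3 -> R)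
    (x : S) : {set S} :=
  [set y : S | edist3 (val x) (val y) == r (val x)].

Lemma num_dist_pairsE (R : realType) (S : {fset 'rV[R]_3}) (r : 'rV[R]_3 -> R) :
  num_dist_pairs S r = (\sum_(x : S) #|out_nbrs r x|)%N.
Proof.
pose A := [set p : S * S | p.2 \in out_nbrs r p.1].
pose vv (p : S * S) := (val p.1, val p.2).
have vv_inj : injective vv.
  by move=> [a b] [c d] [/val_inj -> /val_inj ->].
have -> : num_dist_pairs S r = #|A|.
  rewrite /num_dist_pairs cardE -(size_map vv); apply/perm_size/uniq_perm.
  - exact: fset_uniq.
  - by rewrite map_inj_uniq ?enum_uniq.
  move=> [x y]; rewrite !inE /=; apply/idP/mapP.
    case/andP => /andP[/= xS yS] exy; exists ([` xS], [` yS])%fset => //.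
    by rewrite mem_enum !inE.
  case=> -[a b]; rewrite mem_enum !inE /= => eab [-> ->].
  by rewrite !fsvalP eab.
rewrite -sum1_card (eq_bigl (fun p => p.2 \in out_nbrs r p.1)); last first.
  by move=> p; rewrite inE.
rewrite -(pair_big_dep xpredT (fun x y => y \in out_nbrs r x) (fun _ _ => 1%N)).
by apply: eq_bigr => x _; rewrite sum1_card.
Qed.

Lemma out_nbrs_spherical (R : realType) (S : {fset 'rV[R]_3}) (r : 'rV[R]_3 -> R) :
  spherical (@out_nbrs R S r).
Proof.
have outE (x y : S) : y \in out_nbrs r x -> edist3 (val x) (val y) = r (val x).
  by rewrite inE => /eqP.
move=> x1 x2 x3 x12 x23 x31 /card_gt2P[y1 [y2 [y3 [[]]]]].
move=> /setIP[/setIP[/outE a1 /outE b1] /outE c1].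
move=> /setIP[/setIP[/outE a2 /outE b2] /outE c2].
move=> /setIP[/setIP[/outE a3 /outE b3] /outE c3] [y12 y23 y31].
have [t tE] : exists t, val x3 - val x1 = t *: (val x2 - val x1).
  apply: (@common_centres_collinear _ _ _ _ (val y1) (val y2) (val y3));
    by rewrite ?(inj_eq val_inj) ?a1 ?b1 ?c1.
split.
  apply/fintype.subsetP => y /setIP[/outE a /outE b]; rewrite inE -c1; apply/eqP.
  by apply: sphere_pencil tE _ _; rewrite ?a ?b ?a1 ?b1.
move=> x [/outE d1 /outE d2 /outE d3].
by apply: (line_sphere _ _ _ tE (x := val x));
  rewrite ?(inj_eq val_inj) ?d1 ?d2 ?d3.
Qed.

Lemma edist3_set_const (R : realType) (x a : 'rV[R]_3) (A : set 'rV[R]_3) :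
  A a -> (forall b, A b -> edist3 x b = edist3 x a) -> edist3_set x A = edist3 x a.
Proof.
move=> Aa h; rewrite /edist3_set (_ : [set edist3 x b | b in A] = [set edist3 x a])%classic.
  exact: inf1.
by apply/seteqP; split=> [_ [b Ab <-]|_ ->] /=; [exact: h | exists a].
Qed.

Lemma num_in_ge (R : realType) (S : {fset 'rV[R]_3}) (A : set 'rV[R]_3)
    (B : {set S}) :
  (forall x, x \in B -> A (val x)) -> (#|B| <= num_in S A)%N.
Proof.
move=> BA; rewrite cardE -(size_map val); apply: uniq_leq_size.
  by rewrite map_inj_uniq ?enum_uniq //; exact: val_inj.
move=> _ /mapP[x + ->]; rewrite mem_enum => xB.
by rewrite !inE fsvalP /=; apply/mem_set/BA.
Qed.

Lemma num_in_disjoint (R : realType) (S : {fset 'rV[R]_3}) (A B : set 'rV[R]_3) :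
  (forall x, A x -> ~ B x) -> (num_in S A + num_in S B <= #|` S|)%N.
Proof.
move=> AB; rewrite /num_in -cardfsUI.
set I := (_ `&` _)%fset; have -> : I = fset0.
  apply/fsetP => x; rewrite !inE; apply/negP => /andP[/andP[_ /set_mem xA]].
  by move=> /andP[_ /set_mem]; exact: AB.
rewrite cardfs0 addn0; apply/fsubset_leq_card/fsubsetP => x.
by rewrite !inE => /orP[] /andP[].
Qed.

Theorem theorem3 (R : realType) (eps : R) (eps_gt0 : 0 < eps) :
  exists (delta : R) (n0 : nat), 0 < delta /\
    forall (n : nat) (S : {fset 'rV[R]_3}) (r : 'rV[R]_3 -> R),
      (n0 <= n)%N ->
      #|` S| = n ->
      (forall x, x \in S -> 0 < r x) ->
      (num_dist_pairs S r)%:R > (1 / 4 - delta) * n%:R ^+ 2 ->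
      exists (T : {fset 'rV[R]_3}) (C L : set 'rV[R]_3),
        [/\ (T `<=` S)%fset,
            (#|` T|)%:R < eps * n%:R,
            suspension (S `\` T)%fset r C L,
            `|(num_in S C)%:R - n%:R / 2| < eps * n%:R &
            `|(num_in S L)%:R - n%:R / 2| < eps * n%:R].
Proof.
(* With [eps / 4], each part misses at most that proportion of its half, so [T] has at most
   [eps * n / 2] points. *)
have [|delta [n0 [delta0 stab]]] := @spherical_stability R (eps / 4).
  by rewrite divr_gt0.
(* The 1 ensures [0 < n], which the strict bounds require. *)
exists delta, (maxn n0 1); split=> // n S r; rewrite geq_max => /andP[n0n n1] Sn _.
have cardS : #|{: S}| = n by rewrite -cardfE.
rewrite num_dist_pairsE -cardS => many.
have [|C hC []] := stab _ _ (@out_nbrs_spherical R S r) _ many; first by rewrite cardS.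
rewrite cardS => Cbig Lbig; set D := common_in _ C in Lbig.
have n_gt0 : 0 < n%:R :> R by rewrite ltr0n.
case/heavyP: hC => /card_gt2P[y1 [y2 [y3 [[y1C y2C y3C] [y12 y23 y31]]]]].
move=> [x1 [x2 [x12 CE]]].
have CP (y : S) : y \in C <-> edist3 (val x1) (val y) = r (val x1) /\
    edist3 (val x2) (val y) = r (val x2).
  by rewrite CE !inE; split=> [/andP[/eqP ? /eqP ?]|[-> ->]]; rewrite ?eqxx.
have [e1 e2] := (CP y1).1 y1C; have [f1 f2] := (CP y2).1 y2C.
have [g1 g2] := (CP y3).1 y3C.
have [c [u [rho [u0 rho0 circP axisP]]]] :=
  @spheres_meet_in_circle R (val x1) (val x2) (val y1) (val y2) x12 y12
    (etrans e1 (esym f1)) (etrans e2 (esym f2)).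
pose K := circle3 c u rho; pose L := line3 c u.
have KC (y : S) : y \in C <-> K (val y).
  by rewrite CP; split=> [[h1 h2]|/circP]; [apply/circP|]; rewrite ?e1 ?e2.
(* [x1], [x2] and [z] are each equidistant from [y1], [y2], [y3], so [z] is on the axis. *)
have DL (z : S) : z \in D -> L (val z) /\ forall y, K y -> edist3 (val z) y = r (val z).
  rewrite inE => /fintype.subsetP CD.
  have zL : L (val z).
    have outD y : y \in C -> edist3 (val z) (val y) = r (val z).
      by move=> /CD; rewrite inE => /eqP.
    have [t /(canRL (subrK _))] : exists t, val z - val x1 = t *: (val x2 - val x1).
      apply: (@common_centres_collinear _ _ _ _ (val y1) (val y2) (val y3));
        by rewrite ?(inj_eq val_inj) ?e1 ?e2 ?outD.
    by rewrite addrC => ->; exact: axisP.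
  split=> // y Ky; rewrite (axis_equidistant zL Ky ((KC y1).1 y1C)).
  by have := CD _ y1C; rewrite inE => /eqP.
have KL y : K y -> ~ L y by exact: circle_line_disjoint.
have cK : (#|C| <= num_in S K)%N by apply: num_in_ge => y /KC.
have dL : (#|D| <= num_in S L)%N by apply: num_in_ge => z /DL[].
(* Disjointness turns the lower bound for each part into an upper bound for the other. *)
have KLn := num_in_disjoint S KL; rewrite Sn in KLn.
pose F := C :|: D.
pose G := [fset val x | x in F]%fset.
have GS : (G `<=` S)%fset by apply/fsubsetP => _ /imfsetP[x _ ->]; exact: fsvalP.
have cardG : #|` G| = (#|C| + #|D|)%N.
  rewrite card_imfset /=; last exact: val_inj.
  rewrite -cardE -cardsUI.
  rewrite (_ : C :&: D = finset.set0) ?cards0 ?addn0 //; apply/finset.setP => x; rewrite finset.in_set0.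
  by apply/negP => /setIP[/KC xK /DL[xL _]]; exact: KL xK xL.
move: cK dL KLn; rewrite -!(ler_nat R) natrD => cK dL KLn.
exists (S `\` G)%fset, K, L; split.
- exact: fsubsetDl.
- have /eqP := cardfsID G S.
  rewrite (fsetIidPr GS) cardG Sn -(eqr_nat R) !natrD => /eqP; nra.
- rewrite fsetDK //; split.
  + by exists c, u, rho.
  + by move=> _ /imfsetP[x /= + ->]; rewrite inE => /orP[/KC|/DL[]]; [left|right].
  + move=> _ /imfsetP[x /= + ->]; rewrite inE => /orP[/KC/KL//|/DL[_ h] _].
    (* All of [K] is at distance [r x], and [y1] witnesses that [K] is nonempty, so the infimum is
       [r x]. *)
    have Ky1 := (KC y1).1 y1C.
    by rewrite (edist3_set_const Ky1) => [|b Kb]; rewrite !h.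
- by rewrite ltr_norml; apply/andP; split; nra.
- by rewrite ltr_norml; apply/andP; split; nra.
Qed.
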